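(* For any $k\ge 1$, the generating function $G_k(x)=\sum_n g_{k,n}x^n$ that counts Greek key tours with height $k$ is rational.
   Context: A Greek key tour on the $k\times n$ grid graph ($k$ rows, $n$ columns; vertices are integer points, edges join points at distance $1$) is a directed self-avoiding walk that starts at the upper-left corner vertex and visits every vertex of the grid exactly once. $g_{k,n}$ denotes the number of Greek key tours on the $k\times n$ grid graph, with the convention $g_{k,0}=1$. ''Rational'' means that the formal power series equals a quotient of two polynomials. *)

(* Defs.v *)
From mathcomp Require Import all_boot all_order all_algebra.

Set Implicit Arguments.
Unset Strict Implicit.
Unset Printing Implicit Defensive.

Import GRing.Theory.

(* A vertex is a pair (row, column); rows are numbered from the top and
   columns from the left, so the upper-left corner has coordinates 0, 0. *)
Definition grid_vertex (k n : nat) : finType := ('I_k * 'I_n)%type.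

Definition upper_left (k n : nat) (v : grid_vertex k n) : bool :=
  (v.1 == 0 :> nat) && (v.2 == 0 :> nat).

(* Distance 1 is expressed through the squared Euclidean distance. *)
Definition grid_edge (k n : nat) : rel (grid_vertex k n) :=
  fun u v => (`|u.1 - v.1| ^ 2 + `|u.2 - v.2| ^ 2 == 1)%N.

Definition greek_key_tour (k n : nat) (s : seq (grid_vertex k n)) : bool :=
  if s is v :: p then
    [&& upper_left v, path (@grid_edge k n) v p
      & [forall w, count_mem w (v :: p) == 1]]
  else false.

(* A tour meets each of the k * n vertices once, hence has exactly k * n
   entries: counting among (k * n)-tuples misses no tour. *)
Definition greek_key_count (k n : nat) : nat :=
  if n is 0 then 1
  else #|[set t : (k * n).-tuple (grid_vertex k n) | greek_key_tour t]|.

Local Open Scope ring_scope.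

(* The formal power series \sum_n (f n) x^n is represented by its sequence of
   coefficients f : nat -> R; a polynomial p is the series with coefficients
   fun n => p`_n. *)
Definition fps_mul (R : nzRingType) (f g : nat -> R) : nat -> R :=
  fun n => \sum_(i < n.+1) f i * g (n - i)%N.

(* f = p / q, where q is invertible as a power series. A quotient of
   polynomials that is a power series can always be written this way, by
   cancelling the powers of x common to p and q. *)
Definition fps_rational (F : fieldType) (f : nat -> F) : Prop :=
  exists p q : {poly F},
    q`_0 != 0 /\ fps_mul (fun n => q`_n) f =1 (fun n => p`_n).

Definition greek_key_gf (k : nat) : nat -> rat :=
  fun n => (greek_key_count k n)%:R.

(* Main.v *)
Require Import Defs.
From mathcomp Require Import all_boot all_order all_algebra.
From mathcomp Require Import zify.

(* Transfer matrix method. Label every vertex of the grid with its successor in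
   the tour, or with a stop at the last vertex. Reading the columns from left to
   right turns tours into words over a finite alphabet, and a word comes from a
   tour exactly when its pointers are edges of the grid, some vertex stops, and
   every vertex is reached by following the pointers from the corner: the
   pointer path from the corner to a stop is then forced to visit everything
   once. The last condition can be checked by a finite automaton, because a
   prefix interacts with the rest of the word only through the two columns at
   its right end: it suffices to remember which of these points (and the corner)
   reach which, and which sets of them jointly reach the whole prefix. Counting
   words of a regular language amounts to iterating a fixed matrix, and
   Cayley-Hamilton provides a linear recurrence. *)

Set Implicit Arguments.
Unset Strict Implicit.
Unset Printing Implicit Defensive.

Import GRing.Theory.

(** * Regular languages and their closure properties *)

Definition regular (A : Type) (P : seq A -> Prop) : Prop :=
  exists (Q : finType) (q0 : Q) (d : Q -> A -> Q) (F : pred Q),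
    forall w, P w <-> F (foldl d q0 w).

Lemma regular_and (A : Type) (P P' : seq A -> Prop) :
  regular P -> regular P' -> regular (fun w => P w /\ P' w).
Proof.
move=> [Q [q [d [F FP]]]] [Q' [q' [d' [F' FP']]]].
exists (Q * Q')%type, (q, q'), (fun s a => (d s.1 a, d' s.2 a)),
  (fun s => F s.1 && F' s.2) => w.
have -> : foldl (fun s a => (d s.1 a, d' s.2 a)) (q, q') w =
          (foldl d q w, foldl d' q' w).
  by elim: w q q' {FP FP'} => //= a w IHw q q'; rewrite IHw.
by split=> [[/FP ? /FP' ?]|/andP[/FP ? /FP' ?]] //=; apply/andP.
Qed.

Lemma regular_all (A : Type) (p : pred A) : regular (fun w => all p w).
Proof.
exists bool, true, (fun b a => b && p a), id => w.
suff -> b : foldl (fun b a => b && p a) b w = b && all p w by [].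
by elim: w b => [|a w IHw] b /=; rewrite ?andbT ?IHw ?andbA.
Qed.

Lemma regular_head (A : Type) (p : pred A) :
  regular (fun w => head true (map p w)).
Proof.
(* [None] means that no letter has been read yet; afterwards [odflt] keeps the verdict on the first
   letter. *)
exists (option bool), None, (fun b a => Some (odflt (p a) b)), (odflt true).
case=> [|a w] //=.
suff -> b : foldl (fun b a => Some (odflt (p a) b)) (Some b) w = Some b by [].
by elim: w.
Qed.

Lemma regular_last (A : Type) (p : pred A) :
  regular (fun w => last true (map p w)).
Proof.
exists bool, true, (fun=> p), id => w.
by suff -> b : foldl (fun=> p) b w = last b (map p w) by []; elim: w b => /=.
Qed.

Lemma regular_nil_or_has (A : Type) (p : pred A) :
  regular (fun w => nilp w || has p w).
Proof.
exists (option bool), None, (fun b a => Some (odflt false b || p a)), (odflt true).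
case=> [|a w] //=.
suff -> b : foldl (fun b a => Some (odflt false b || p a)) (Some b) w =
  Some (b || has p w) by [].
by elim: w b => [|a' w IHw] b /=; rewrite ?orbF ?IHw ?orbA.
Qed.

(** * Rationality of the counting series of a regular language *)

Section Rationality.

Local Open Scope ring_scope.

(** The denominator is the reciprocal polynomial of [c], with constant term the leading coefficient
    1 of [c]. The recurrence says that its product with the series vanishes from degree [d] on, so
    the truncated product is the numerator. *)
Lemma linear_recurrence_rational (F : fieldType) (c : {poly F}) (f : nat -> F) :
  c \is monic -> (forall n, \sum_(l < size c) c`_l * f (n + l)%N = 0) ->
  fps_rational f.
Proof.
move=> cmon crec; have c0 := monic_neq0 cmon.
have [d sc] : exists d, size c = d.+1.
  by exists (size c).-1; rewrite prednK // size_poly_gt0.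
pose q := \poly_(i < d.+1) c`_(d - i).
exists (\poly_(n < d) fps_mul (fun n => q`_n) f n), q; split.
  move: cmon; rewrite coef_poly /= subn0 monicE lead_coefE sc /= => /eqP->.
  exact: oner_neq0.
move=> n; rewrite coef_poly; case: ltnP => // dn.
rewrite /fps_mul -(big_mkord xpredT (fun i => q`_i * f (n - i)%N)).
rewrite -[RHS](crec (n - d)%N) sc.
rewrite (@big_cat_nat _ _ _ d.+1) //=.
rewrite [X in _ + X]big_nat_cond [X in _ + X]big1 ?addr0; last first.
  by move=> i /andP[/andP[di _] _]; rewrite coef_poly ltnNge di mul0r.
rewrite big_nat_rev /= big_mkord; apply: eq_bigr => i _.
have id : (i <= d)%N by rewrite -ltnS.
rewrite add0n subSS coef_poly ltnS leq_subr subKn // subnBA //.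
by rewrite addnC -addnBA // addnC.
Qed.

Lemma matrix_power_recurrence (F : fieldType) (m : nat) (M : 'M[F]_m.+1)
    (v : nat -> 'cV[F]_m.+1) (i : 'I_m.+1) :
  (forall n, v n.+1 = M *m v n) -> fps_rational (fun n => v n i ord0).
Proof.
move=> vS; have vD n l : v (n + l)%N = M ^+ l *m v n.
  elim: l => [|l IHl]; first by rewrite addn0 expr0 mul1mx.
  by rewrite addnS vS IHl mulmxA exprS.
apply: (@linear_recurrence_rational _ (char_poly M)); first exact: char_poly_monic.
move=> n; have := Cayley_Hamilton M.
rewrite /horner_mx /horner_morph horner_coef size_map_poly => CH.
have -> : \sum_(l < size (char_poly M)) (char_poly M)`_l * v (n + l)%N i ord0 =
  ((\sum_(l < size (char_poly M)) ((char_poly M)`_l)%:M * M ^+ l) *m v n) i ord0.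
  rewrite mulmx_suml summxE; apply: eq_bigr => l _.
  by rewrite vD -[_ * M ^+ l]/(_ *m _) -mulmxA mul_scalar_mx [RHS]mxE.
under eq_bigr => l _ do rewrite -coef_map /=.
by rewrite CH mul0mx mxE.
Qed.

Lemma sum_tupleS (V : nmodType) (A : finType) (n : nat) (f : seq A -> V) :
  \sum_(t : n.+1.-tuple A) f t = \sum_(a : A) \sum_(t : n.-tuple A) f (a :: t).
Proof.
rewrite pair_big /=.
rewrite (reindex (fun x : A * n.-tuple A => [tuple of x.1 :: x.2])) //=.
exists (fun t : n.+1.-tuple A => (thead t, [tuple of behead t])) => [[a t]|t] _ /=.
  by congr pair; apply: val_inj.
by rewrite [RHS]tuple_eta.
Qed.

(** As [P] is a mere proposition, words are counted through any finite set [D] that matches it. *)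
Lemma regular_rational (A : finType) (P : seq A -> Prop) (c : nat -> nat) :
  regular P ->
  (forall n (D : {set n.-tuple A}), (forall t : n.-tuple A, t \in D <-> P t) ->
     c n = #|D|) ->
  fps_rational (fun n => (c n)%:R : rat).
Proof.
move=> [Q [q0 [d [F FP]]]] cP.
(* [g n q] counts the words of length [n] accepted from state [q]. Splitting off the first letter
   shows that the vector of these counts is multiplied by the transfer matrix at each step. *)
pose g n q : rat := \sum_(t : n.-tuple A) (F (foldl d q t))%:R.
have gS n q : g n.+1 q = \sum_(q' : Q) #|[set a | d q a == q']|%:R * g n q'.
  rewrite /g (sum_tupleS n (fun w => (F (foldl d q w))%:R)) /=.
  rewrite (partition_big (d q) xpredT) //=; apply: eq_bigr => q' _.
  under eq_bigr => a /eqP-> do [].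
  by rewrite sumr_const mulr_natl; congr (_ *+ _); apply: eq_card => a; rewrite inE.
have cg n : (c n)%:R = g n q0.
  rewrite (cP n [set t : n.-tuple A | F (foldl d q0 t)]); last first.
    by move=> t; rewrite inE; split=> /FP.
  rewrite -sum1_card natr_sum big_mkcond; apply: eq_bigr => t _.
  by rewrite inE; case: (F _).
have Qgt0 : (0 < #|Q|)%N by apply/card_gt0P; exists q0.
have Qm := prednK Qgt0; set m := #|Q|.-1 in Qm.
pose e (i : 'I_m.+1) : Q := enum_val (cast_ord Qm i).
pose e' (q : Q) : 'I_m.+1 := cast_ord (esym Qm) (enum_rank q).
have e'K : cancel e' e by move=> q; rewrite /e /e' cast_ordKV enum_rankK.
have eK : cancel e e' by move=> i; rewrite /e /e' enum_valK cast_ordK.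
pose M : 'M[rat]_m.+1 := \matrix_(i, j) #|[set a | d (e i) a == e j]|%:R.
pose v n : 'cV[rat]_m.+1 := \col_i g n (e i).
have [|p [q [q0n pq]]] := @matrix_power_recurrence _ m M v (e' q0).
  move=> n; apply/colP => i; rewrite !mxE gS (reindex e) /=; last first.
    by exists e' => ? _.
  by apply: eq_bigr => j _; rewrite !mxE.
exists p, q; split=> // n; rewrite -pq /fps_mul; apply: eq_bigr => i _.
by rewrite mxE e'K cg.
Qed.

End Rationality.

(** * Reachability along the pointers of a word *)

Definition reachable (T : eqType) (e : rel T) (x y : T) : Prop :=
  exists2 p, path e x p & y = last x p.

Lemma reachable_refl (T : eqType) (e : rel T) x : reachable e x x.
Proof. by exists [::]. Qed.

Lemma reachable_edge (T : eqType) (e : rel T) x y : e x y -> reachable e x y.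
Proof. by move=> exy; exists [:: y] => //=; rewrite exy. Qed.

Lemma reachable_trans (T : eqType) (e : rel T) x y z :
  reachable e x y -> reachable e y z -> reachable e x z.
Proof.
move=> [p ep ->] [p' ep' ->].
by exists (p ++ p'); rewrite ?cat_path ?ep ?last_cat.
Qed.

Lemma sub_reachable (T : eqType) (e e' : rel T) x y :
  subrel e e' -> reachable e x y -> reachable e' x y.
Proof. by move=> ee' [p ep ->]; exists p => //; apply: sub_path ep. Qed.

(* A letter describes one column of a pointer system on the grid: the entry at
   row [i] is the row of the vertex pointed at together with its column,
   relative to the column just left of the described one. *)
Definition letter (k : nat) : finType := {ffun 'I_k -> option ('I_k * 'I_3)}.

(* The columns described by a word are numbered from 1, so that a pointer can
   leave the grid on the left without truncation. *)
Definition target (k : nat) (w : seq (letter k)) (x : 'I_k * nat) :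
    option ('I_k * nat) :=
  if x.2 is j.+1 then
    omap (fun t : 'I_k * 'I_3 => (t.1, j + t.2)) (nth [ffun=> None] w j x.1)
  else None.

Definition target_rel (k : nat) (w : seq (letter k)) : rel ('I_k * nat) :=
  fun x y => target w x == Some y.

Definition all_reachable (k : nat) (r : 'I_k) (w : seq (letter k)) : Prop :=
  forall v : 'I_k * nat, 0 < v.2 <= size w -> reachable (target_rel w) (r, 1) v.

(** * The automaton deciding that the corner reaches everything *)

Section Transfer.

Variables (k : nat) (r : 'I_k).
Implicit Types (w : seq (letter k)) (a : letter k) (v : 'I_k * nat).

Lemma target_size w v y : target w v = Some y -> 0 < v.2 <= size w.
Proof.
case: v => i [|j] //=; rewrite /target /=; case: ltnP => // wj.
by rewrite nth_default // ffunE.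
Qed.

Lemma target_le w v y : target w v = Some y -> y.2 <= v.2.+1.
Proof.
case: v => i [|j] //=; rewrite /target /=.
by case: (nth _ w j i) => [[i' c]|] //= [<-] /=; have := ltn_ord c; lia.
Qed.

Lemma target_rcons w a v : target (rcons w a) v =
  if v.2 == (size w).+1 then
    omap (fun t : 'I_k * 'I_3 => (t.1, size w + t.2)) (a v.1)
  else target w v.
Proof.
case: v => i [|j] //=; rewrite /target /= eqSS nth_rcons.
by case: ltngtP => [||->] // wj; rewrite nth_default // ltnW.
Qed.

Lemma target_rel_rcons w a : subrel (target_rel w) (target_rel (rcons w a)).
Proof.
move=> x y /eqP xy; rewrite /target_rel target_rcons xy eqn_leq.
by have /andP[_] := target_size xy; rewrite ltnNge => ->; rewrite andbF.
Qed.

Lemma reachable_from_outside w v v' :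
  size w < v.2 -> reachable (target_rel w) v v' -> v' = v.
Proof.
move=> wv [[|y p]] //= /andP[/eqP/target_size/andP[_ vw] _] _.
by rewrite ltnNge vw in wv.
Qed.

(** A pointer of [w] starts in a column at most [size w] and advances by at most one column, so none
    ends beyond column [(size w).+1]. *)
Lemma reachable_to_outside w v v' :
  (size w).+1 < v'.2 -> reachable (target_rel w) v v' -> v' = v.
Proof.
move=> wv [p]; elim/last_ind: p => [|p y _] //.
rewrite rcons_path last_rcons => /andP[_ /eqP xy] ?; subst y.
by have := target_le xy; have := target_size xy; lia.
Qed.

(** With [m = size w], a boundary point is the corner ([None]) or lies in column [m] or [m.+1]. The
    window adds column [m.+2], so it contains the boundaries before and after one more letter is
    read. *)
Definition boundary : finType := option ('I_k * bool).
Definition window : finType := option ('I_k * 'I_3).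

Definition boundary_pt (m : nat) (x : boundary) : 'I_k * nat :=
  if x is Some (i, b) then (i, m + b) else (r, 1).
Definition window_pt (m : nat) (x : window) : 'I_k * nat :=
  if x is Some (i, c) then (i, m + c) else (r, 1).

Definition left_window (x : boundary) : window :=
  if x is Some (i, b) then Some (i, inord b) else None.
Definition right_window (x : boundary) : window :=
  if x is Some (i, b) then Some (i, inord b.+1) else None.

Lemma left_window_pt m x : window_pt m (left_window x) = boundary_pt m x.
Proof. by case: x => [[i []]|] //=; rewrite inordK. Qed.

Lemma right_window_pt m x : window_pt m (right_window x) = boundary_pt m.+1 x.
Proof. by case: x => [[i []]|] //=; rewrite inordK // addnS addSn. Qed.

Lemma windowP m (p : window) :
  (exists x, p = left_window x) \/ (exists i, p = Some (i, ord_max) /\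
    window_pt m p = (i, m.+2)).
Proof.
case: p => [[i c]|]; last by left; exists None.
case: (ltnP c 2) => c2; [left|right].
  exists (Some (i, 0 < c)) => /=; congr (Some (_, _)); apply: val_inj.
  by case: c c2 => [[|[|[]]]] //= ? _; rewrite inordK.
have -> : c = ord_max by apply: val_inj => /=; have := ltn_ord c; lia.
by exists i; rewrite /= addn2.
Qed.

(** Sets of boundary points are needed in the second component: after a new letter, a single point
    may enter the old prefix through several old boundary points that cover it only jointly. *)
Definition state : finType := ({set boundary * boundary} * {set {set boundary}})%type.

(** A step is either a whole path through the old prefix or one new pointer. The new pointers start
    in the middle column of the window, and their offsets are already window coordinates. *)
Definition window_rel (R : {set boundary * boundary}) (a : letter k) :
    rel window :=
  fun p q =>
    [exists xy in R, (p == left_window xy.1) && (q == left_window xy.2)]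
    || (if (p, q) is (Some (i, c), Some t) then
          (c == 1 :> nat) && (a i == Some t) else false).

Definition transfer (s : state) (a : letter k) : state :=
  let conn := connect (window_rel s.1 a) in
  ([set xy | conn (right_window xy.1) (right_window xy.2)],
   [set E : {set boundary} |
     ([set x | [exists y in E, conn (right_window y) (left_window x)]] \in s.2)
     && [forall i, exists y in E, conn (right_window y) (Some (i, inord 1))]]).

(** Points are compared rather than names, since [None] and [Some (r, true)] both denote the corner
    here. Covering the empty prefix is vacuous. *)
Definition init : state :=
  ([set xy | boundary_pt 0 xy.1 == boundary_pt 0 xy.2], setT).

Definition summarizes (w : seq (letter k)) (s : state) : Prop :=
  (forall x y, (x, y) \in s.1 <->
     reachable (target_rel w) (boundary_pt (size w) x) (boundary_pt (size w) y)) /\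
  (forall E, E \in s.2 <-> forall v, 0 < v.2 <= size w ->
     exists2 x, x \in E & reachable (target_rel w) (boundary_pt (size w) x) v).

Lemma summarizes_init : summarizes [::] init.
Proof.
split=> [x y|E]; rewrite inE; last by split=> // _ v; case: (v.2).
split=> [/eqP-> /=|/= [[|z p] /=]]; first exact: reachable_refl.
  by move=> _ ->.
by move=> /andP[/eqP/target_size/andP[]]; case: (boundary_pt 0 x).2.
Qed.

Section Step.

Variables (w : seq (letter k)) (s : state) (a : letter k).
Hypothesis sw : summarizes w s.
Let m := size w.
Let conn := connect (window_rel s.1 a).

(** A window point in column [m.+2] has only trivial paths of [w] from or to it; all other paths
    join boundary points and are recorded in [s.1]. *)
Lemma reachable_conn_left p q :
  reachable (target_rel w) (window_pt m p) (window_pt m q) -> conn p q.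
Proof.
have [[x ->]|[i [-> pm]]] := windowP m p; last first.
  rewrite pm => /reachable_from_outside/= /(_ (leqnSn _)).
  have [[y ->]|[j [-> ->]]] := windowP m q; last by case=> ->; exact: connect0.
  rewrite left_window_pt.
  by case: y => [[j b]|] [] //= ?; case: b; lia.
have [[y ->]|[j [-> qm]]] := windowP m q.
  rewrite !left_window_pt => /sw.1 xy; apply: connect1.
  by apply/orP; left; apply/existsP; exists (x, y); rewrite xy !eqxx.
rewrite qm => /reachable_to_outside/= /(_ (leqnn _)).
rewrite left_window_pt.
by case: x => [[i b]|] [] //= ?; case: b; lia.
Qed.

(** The path is cut after its last new pointer: that pointer lands in the window, and what follows
    uses [w] alone. The induction extends the path at its end. *)
Lemma reachable_window p v :
  reachable (target_rel (rcons w a)) (window_pt m p) v ->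
  exists2 q, conn p q & reachable (target_rel w) (window_pt m q) v.
Proof.
move=> [l]; elim/last_ind: l v => [|l z IHl] v.
  by move=> _ ->; exists p; [exact: connect0|exact: reachable_refl].
rewrite rcons_path last_rcons => /andP[/IHl/(_ erefl)[q pq qy] yz] ->.
move: (last _ _) qy yz => [i j] qy /eqP; rewrite target_rcons /=.
case: eqP => [ji|_] yz; last first.
  exists q => //; apply: reachable_trans qy _; apply: reachable_edge; exact/eqP.
case ai: (a i) yz => [[i' c]|] //= [<-].
exists (Some (i', c)); last exact: reachable_refl.
apply: (connect_trans pq); apply: (@connect_trans _ _ (Some (i, inord 1))).
  by apply: reachable_conn_left; rewrite /= inordK // addn1 /m -ji.
by apply: connect1; apply/orP; right; rewrite inordK // ai !eqxx.
Qed.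

Lemma conn_reachable p q :
  conn p q -> reachable (target_rel (rcons w a)) (window_pt m p) (window_pt m q).
Proof.
case/connectP => l; elim: l p => [|z l IHl] p /=.
  by move=> _ ->; exact: reachable_refl.
move=> /andP[pz /IHl zq] /zq; apply: reachable_trans.
case/orP: pz => [/existsP[[x y] /and3P[/sw.1 xy /eqP-> /eqP->]]|].
  rewrite !left_window_pt; apply: sub_reachable xy; exact: target_rel_rcons.
case: p z {zq} => [[i c]|] // [[i' c']|] // /andP[/eqP c1 /eqP ai].
by apply: reachable_edge; rewrite /target_rel target_rcons /= c1 addn1 eqxx ai.
Qed.

Lemma connP p q :
  conn p q <-> reachable (target_rel (rcons w a)) (window_pt m p) (window_pt m q).
Proof.
split=> [|/reachable_window[z pz /reachable_conn_left]].
  exact: conn_reachable.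
exact: connect_trans.
Qed.

Lemma summarizes_transfer : summarizes (rcons w a) (transfer s a).
Proof.
rewrite /summarizes size_rcons -/m; split=> [x y|E]; rewrite inE -/conn.
  by rewrite -!right_window_pt; exact: connP.
split=> [/andP[/sw.2 old /forallP new] v|cov].
  rewrite [_ <= m.+1]leq_eqVlt ltnS => /andP[v0 /orP[/eqP vm|vm]].
    have /existsP[y /andP[yE /connP]] := new v.1.
    rewrite right_window_pt /= inordK // addn1 -vm -surjective_pairing.
    by exists y.
  have [|x] := old v; first by rewrite v0.
  rewrite inE => /existsP[y /andP[yE /connP yx]] xv; exists y => //.
  rewrite -right_window_pt; apply: reachable_trans yx _.
  rewrite left_window_pt; apply: sub_reachable xv; exact: target_rel_rcons.
apply/andP; split.
  apply/sw.2 => v /andP[v0 vm].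
  have [|y yE] := cov v; first by rewrite v0 ltnW.
  rewrite -right_window_pt => /reachable_window[q yq qv].
  (* The point [q] cannot lie in column [m.+2]: no pointer of [w] starts there, whereas [v] lies in
     a column at most [m]. *)
  have [[x qE]|[i [_ qE]]] := windowP m q; last first.
    move: qv; rewrite qE => /reachable_from_outside/= /(_ (leqnSn _)) vE.
    by rewrite vE ltnNge leqnSn in vm *; lia.
  exists x; last by rewrite -left_window_pt -qE.
  by rewrite inE; apply/existsP; exists y; rewrite yE -qE.
apply/forallP => i; have [|y yE yi] := cov (i, m.+1); first by rewrite /=.
apply/existsP; exists y; rewrite yE; apply/connP.
by rewrite right_window_pt /= inordK // addn1.
Qed.

End Step.

Lemma summarizes_foldl w : summarizes w (foldl transfer init w).
Proof.
elim/last_ind: w => [|w a IHw]; first exact: summarizes_init.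
by rewrite -cats1 foldl_cat cats1; exact: summarizes_transfer.
Qed.

Lemma regular_all_reachable : regular (all_reachable r).
Proof.
(* Acceptance means that the corner alone covers the whole word. *)
exists state, init, transfer, (fun s : state => [set None] \in s.2) => w.
have [_ cw] := summarizes_foldl w; split=> [rw|/cw rw v /rw].
  by apply/cw => v /rw; exists None; rewrite ?inE.
by case=> x; rewrite inE => /eqP->.
Qed.

End Transfer.

(** * The regular language of tour words *)

(** Offset 1 is the described column itself, so this is the grid edge condition in relative
    coordinates. *)
Definition letter_valid (k : nat) (a : letter k) : bool :=
  [forall i, if a i is Some t then `|i - t.1| ^ 2 + `|1 - t.2| ^ 2 == 1 else true].
Definition letter_avoids (c : nat) (k : nat) (a : letter k) : bool :=
  [forall i, if a i is Some t then t.2 != c :> nat else true].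
Definition letter_stops (k : nat) (a : letter k) : bool := [exists i, a i == None].

(* The empty word is admitted, matching the convention g_{k,0} = 1. *)
Definition tour_word (k : nat) (r : 'I_k) (w : seq (letter k)) : Prop :=
  all (@letter_valid k) w /\ head true (map (@letter_avoids 0 k) w) /\
  last true (map (@letter_avoids 2 k) w) /\
  (nilp w || has (@letter_stops k) w) /\ all_reachable r w.

Lemma regular_tour_word (k : nat) (r : 'I_k) : regular (tour_word r).
Proof.
apply: regular_and; first exact: regular_all.
apply: regular_and; first exact: regular_head.
apply: regular_and; first exact: regular_last.
apply: regular_and; first exact: regular_nil_or_has.
exact: regular_all_reachable.
Qed.

(** Deterministic paths from one start agree as long as both last, and [p] ends where no step is
    possible, so [q] cannot outrun it. *)
Lemma deterministic_path (T : eqType) (e : rel T) (x : T) (p q : seq T) :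
  (forall u v v', e u v -> e u v' -> v = v') ->
  path e x p -> path e x q -> (forall y, ~~ e (last x p) y) ->
  last x q \in x :: p.
Proof.
move=> edet; elim: q x p => [|y q IHq] x p; first by rewrite mem_head.
case: p => [|y' p] /=; first by move=> _ /andP[xy _] /(_ y); rewrite xy.
move=> /andP[xy' yp] /andP[xy yq] stop.
by rewrite -(edet _ _ _ xy' xy) in yq *; rewrite in_cons IHq ?orbT.
Qed.

(** * The bijection between tours and tour words *)

Section Tours.

Variables (k' n' : nat).
Notation k := k'.+1.
Notation n := n'.+1.
Notation V := (grid_vertex k n).
Notation corner := ((ord0, ord0) : V).

Definition emb (v : V) : 'I_k * nat := (v.1, v.2.+1).

(** The index falls off the list at the last vertex, where the default [None] serves as the stop. *)
Definition arrow (s : seq V) (v : V) : option V :=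
  nth None (map Some s) (index v s).+1.

Definition word_of_tour (s : seq V) : n.-tuple (letter k) :=
  [tuple [ffun i => omap (fun u : V => (u.1, inord (u.2.+1 - j))) (arrow s (i, j))]
    | j < n].

Lemma emb_inj : injective emb.
Proof. by move=> [i j] [i' j'] [-> /val_inj->]. Qed.

Lemma greek_key_tourP (s : seq V) :
  reflect (exists p, [/\ s = corner :: p, path (@grid_edge k n) corner p,
                         uniq (corner :: p) & forall v, v \in corner :: p])
          (greek_key_tour s).
Proof.
apply: (iffP idP) => [|[p [-> pp up cov]]].
  case: s => [|v p] //= /and3P[/andP[/eqP v1 /eqP v2] pp /forallP cov].
  have vE : v = corner by case: v v1 v2 {pp cov} => i j /= ? ?; congr pair; exact: val_inj.
  subst v; have cov1 v : count_mem v (corner :: p) = 1 by exact/eqP/cov.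
  have covp v : v \in corner :: p by rewrite -has_pred1 has_count cov1.
  exists p; split=> //; rewrite -[_ && _]/(uniq (corner :: p)).
  by apply: count_mem_uniq => v; rewrite cov1 covp.
rewrite /= pp /=; apply/forallP => v.
by move: (count_uniq_mem v up); rewrite cov => /= ->.
Qed.

Lemma grid_edge_near (i i' : 'I_k) (j j' : 'I_n) :
  grid_edge ((i, j) : V) (i', j') -> (j <= j'.+1) && (j' <= j.+1).
Proof.
rewrite /grid_edge /=; set a := absz _; set b := absz _ => ab.
have b1 : b <= 1 by case: b ab => [|[|b]] //; lia.
by rewrite /b in b1; lia.
Qed.

Lemma nth_word_of_tour s (j : 'I_n) : nth [ffun=> None] (word_of_tour s) j =
  [ffun i => omap (fun u : V => (u.1, inord (u.2.+1 - j))) (arrow s (i, j))].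
Proof. by rewrite -tnth_nth tnth_mktuple. Qed.

Lemma arrow_edge s v u :
  greek_key_tour s -> arrow s v = Some u -> grid_edge v u.
Proof.
case/greek_key_tourP => p [-> /(pathP corner) pp up cov].
rewrite /arrow -[index _ _]/(index v (corner :: p)).
case: (ltnP (index v (corner :: p)).+1 (size (corner :: p))) => ip; last first.
  by rewrite nth_default // size_map.
rewrite (nth_map corner) // => -[<-].
by rewrite -[v in grid_edge v _](nth_index corner (cov v)); apply: pp.
Qed.

(** Successive vertices lie in columns at most one apart, so neither the truncated subtraction nor
    [inord] distorts the offset. *)
Lemma target_word_of_tour s v : greek_key_tour s ->
  target (word_of_tour s) (emb v) = omap emb (arrow s v).
Proof.
case: v => i j ts; rewrite /target /= nth_word_of_tour ffunE.
case av: (arrow s (i, j)) => [[i' j']|] //=; congr (Some (_, _)).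
by have near := grid_edge_near (arrow_edge ts av); rewrite inordK /=; lia.
Qed.

Lemma arrow_nth s i : uniq s -> i.+1 < size s ->
  arrow s (nth corner s i) = Some (nth corner s i.+1).
Proof. by move=> us si; rewrite /arrow index_uniq ?(nth_map corner) // ltnW. Qed.

Lemma tour_word_of_tour s : greek_key_tour s -> tour_word ord0 (word_of_tour s).
Proof.
move=> ts; have [p [sE pp up cov]] := greek_key_tourP _ ts.
have tE j : tnth (word_of_tour s) j = nth [ffun=> None] (word_of_tour s) j.
  exact: tnth_nth.
split; [|split; [|split; [|split]]].
- apply/allP => a /tnthP[j ->]; rewrite tE nth_word_of_tour.
  apply/forallP => i; rewrite ffunE.
  case av: (arrow s (i, j)) => [[i' j']|] //=.
  have uv := arrow_edge ts av; have /= near := grid_edge_near uv.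
  move: uv; rewrite /grid_edge /= => uv; rewrite inordK; last by lia.
  have <- : `|j - j'| = `|1 - (j'.+1 - j)%N| by lia.
  exact: uv.
- rewrite -nth0 (nth_map [ffun=> None]) ?size_tuple //.
  rewrite (nth_word_of_tour s ord0); apply/forallP => i; rewrite ffunE.
  case av: (arrow s (i, ord0)) => [[i' j']|] //=.
  by have /= near := grid_edge_near (arrow_edge ts av); rewrite inordK; lia.
- rewrite -nth_last size_map size_tuple (nth_map [ffun=> None]) ?size_tuple //.
  rewrite (nth_word_of_tour s ord_max); apply/forallP => i; rewrite ffunE.
  case av: (arrow s (i, ord_max)) => [[i' j']|] //=.
  have /= near := grid_edge_near (arrow_edge ts av); have := ltn_ord j'.
  by rewrite inordK; lia.
- apply/orP; right; apply/hasP; pose z := last corner p.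
  exists (tnth (word_of_tour s) z.2); first exact: mem_tnth.
  rewrite tE nth_word_of_tour; apply/existsP; exists z.1.
  rewrite ffunE -surjective_pairing /arrow sE index_last //.
  by rewrite nth_default // size_map.
move=> [i [|j]] //=; rewrite size_tuple card_ord => jn.
have vs := cov (i, Ordinal jn); rewrite -sE in vs.
have -> : (i, j.+1) = emb (nth corner s (index (i, Ordinal jn) s)).
  by rewrite nth_index.
have : index (i, Ordinal jn) s < size s by rewrite index_mem.
(* The vertex at position [l] of the tour is reached by following [l] pointers from the corner. *)
elim: (index _ _) => [|l IHl] ls; first by rewrite sE; exact: reachable_refl.
apply: reachable_trans (IHl (ltnW ls)) _; apply: reachable_edge; apply/eqP.
by rewrite target_word_of_tour // arrow_nth // sE.
Qed.

(** The word determines all successors, and a tour is recovered by iterating them from the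
    corner. *)
Lemma word_of_tour_inj (s s' : seq V) : size s = size s' ->
  greek_key_tour s -> greek_key_tour s' ->
  word_of_tour s = word_of_tour s' -> s = s'.
Proof.
move=> ss' ts ts' ww'; have aa' v : arrow s v = arrow s' v.
  by apply: (inj_omap emb_inj); rewrite -!target_word_of_tour // ww'.
have [p [sE _ up _]] := greek_key_tourP _ ts.
have [p' [sE' _ up' _]] := greek_key_tourP _ ts'.
apply: (eq_from_nth (x0 := corner)) => // i; elim: i => [|i IHi] si.
  by rewrite sE sE'.
have := aa' (nth corner s i); rewrite {2}(IHi (ltnW si)) !arrow_nth -?ss' //.
- by case.
- by rewrite sE'.
- by rewrite sE.
Qed.

Section FromWord.

Variable t : n.-tuple (letter k).
Hypothesis tw : tour_word ord0 t.
Let e : rel V := fun u v => target_rel t (emb u) (emb v).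

Lemma target_inside v y :
  target t (emb v) = Some y -> exists2 u, y = emb u & grid_edge v u.
Proof.
have [/allP valid [left [right _]]] := tw; case: v => vi vj; rewrite /target /=.
case av: (nth _ t vj vi) => [[i c]|] //= [<-].
have /valid/forallP/(_ vi) : nth [ffun=> None] t vj \in t.
  by rewrite mem_nth // size_tuple.
rewrite av /= => ai.
(* The conditions on the first and last letters keep pointers from leaving the grid on either
   side. *)
have c0 : vj = 0 :> nat -> c != 0 :> nat.
  move=> v0; move: left; rewrite -nth0 (nth_map [ffun=> None]) ?size_tuple //.
  by rewrite v0 in av; move/forallP/(_ vi); rewrite av.
have c2 : vj = n' :> nat -> c != 2 :> nat.
  move=> vn; move: right; rewrite -nth_last size_map size_tuple /=.
  rewrite (nth_map [ffun=> None]) ?size_tuple //.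
  by rewrite vn in av; move/forallP/(_ vi); rewrite av.
have [c3 vn] := (ltn_ord c, ltn_ord vj).
have jn : (vj + c).-1 < n by lia.
exists (i, Ordinal jn); first by congr pair => /=; lia.
rewrite /grid_edge /=.
have -> : `|vj - (vj + c).-1| = `|1 - c| by lia.
exact: ai.
Qed.

Lemma path_inside v q : path (target_rel t) (emb v) q ->
  exists2 q', q = map emb q' & path e v q'.
Proof.
elim: q v => [|y q IHq] v /=; first by exists [::].
move=> /andP[/[dup] vy /eqP/target_inside[u yu _]]; rewrite yu in vy *.
by move=> /IHq[q' -> uq]; exists (u :: q') => //=; rewrite uq andbT.
Qed.

Lemma reachable_inside v : reachable e corner v.
Proof.
have [_ [_ [_ [_ reach]]]] := tw.
have [|q cq] := reach (emb v); first by rewrite /= size_tuple ltn_ord.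
have [q' -> eq'] := @path_inside corner q cq.
by rewrite -[(ord0, 1)]/(emb corner) last_map => /emb_inj->; exists q'.
Qed.

Lemma tour_of_word : exists2 s : seq V, greek_key_tour s & word_of_tour s = t.
Proof.
have [_ [_ [_ [stop _]]]] := tw.
have [z zstop] : exists z, target t (emb z) = None.
  move: stop; rewrite /nilp size_tuple /= => /hasP[a /tnthP[j ->]].
  move=> /existsP[i /eqP ai]; exists (i, j).
  by rewrite /target /= -tnth_nth ai.
(* A simple path from the corner to a stop is the tour: by determinism it meets every reachable
   vertex, hence all of them. *)
have [p0 ep0] := reachable_inside z; case/shortenP: ep0 => p ep up _ pz.
have cov v : v \in corner :: p.
  have [q eq ->] := reachable_inside v; apply: deterministic_path eq _ => //.
    by move=> u y y' /eqP uy /eqP; rewrite uy => /Some_inj/emb_inj.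
  by move=> y; rewrite -pz /e /target_rel zstop.
have ts : greek_key_tour (corner :: p).
  apply/greek_key_tourP; exists p; split=> //; apply: sub_path ep => u v.
  by move=> /eqP/target_inside[y /emb_inj->].
exists (corner :: p) => //; apply: eq_from_tnth => j; apply/ffunP => i.
rewrite tnth_mktuple ffunE (tnth_nth [ffun=> None]).
have -> : omap (fun u : V => (u.1, inord (u.2.+1 - j) : 'I_3)) (arrow (corner :: p) (i, j))
  = nth [ffun=> None] (word_of_tour (corner :: p)) j i.
  by rewrite nth_word_of_tour ffunE.
(* At the last vertex both sides stop, since that vertex is [z]; elsewhere the arrow is the next
   step of the pointer path. *)
have targetE : target (word_of_tour (corner :: p)) (emb (i, j)) = target t (emb (i, j)).
  rewrite target_word_of_tour // -(nth_index corner (cov (i, j))).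
  set l := index _ _; have lp : l < size (corner :: p) by rewrite index_mem.
  move: lp; rewrite leq_eqVlt => /orP[/eqP lp|lp].
    rewrite /arrow index_uniq -?lp // nth_default ?size_map -?lp //=.
    by rewrite (_ : nth _ _ _ = z) ?zstop // pz (last_nth corner) (succn_inj lp).
  by rewrite arrow_nth //; apply/esym/eqP; apply: (pathP corner ep).
move: targetE; rewrite /target /=.
case: (nth _ (word_of_tour _) j i) => [[i1 c1]|]; case: (nth _ t j i) => [[i2 c2]|] //= [-> cc].
by congr (Some (_, _)); apply: val_inj; apply: (addnI cc).
Qed.

End FromWord.

Lemma greek_key_count_word (D : {set n.-tuple (letter k)}) :
  (forall t : n.-tuple (letter k), t \in D <-> tour_word ord0 t) ->
  greek_key_count k n = #|D|.
Proof.
move=> DP; rewrite /greek_key_count.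
set S := [set _ | _]; pose f (s : (k * n).-tuple V) := word_of_tour s.
have <- : f @: S = D.
  apply/setP => t; apply/imsetP/idP => [[s]|/DP/tour_of_word[s ts st]].
    by rewrite inE => ts ->; apply/DP; exact: tour_word_of_tour.
  have [p [sE _ up cov]] := greek_key_tourP _ ts.
  have sk : size s == k * n.
    rewrite sE -(card_uniqP up) -[k in k * _]card_ord -[n in _ * n]card_ord.
    by rewrite -card_prod; apply/eqP/eq_card => v; rewrite cov.
  by exists (Tuple sk); rewrite ?inE.
rewrite card_in_imset // => s s'; rewrite !inE => ts ts' ff; apply: val_inj.
by apply: word_of_tour_inj ff; rewrite ?size_tuple.
Qed.

End Tours.

Theorem theorem7p1 (k : nat) (hk : (1 <= k)%N) : fps_rational (greek_key_gf k).
Proof.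
case: k hk => // k _; apply: regular_rational (regular_tour_word (@ord0 k)) _.
case=> [|n] D DP; last exact: greek_key_count_word.
(* The empty word is accepted, which gives the value 1 at [n = 0]. *)
have -> : D = setT.
  apply/setP => t; rewrite inE; apply/DP; rewrite tuple0; do 4 split=> //.
  by move=> v; case: v.2.
by rewrite cardsT card_tuple.
Qed.
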